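(* Let $\Gamma$ be a vertex decomposable simplicial complex on $[n]$. Then its Alexander dual $\Gamma^\vee$ is chordal.
   Context: A simplicial complex on $[n]=\{1,\dots,n\}$ is a set $\Gamma$ of subsets of $[n]$ (faces) closed under taking subsets; the void complex $\emptyset$ is allowed and singletons need not be faces. $\dim F=|F|-1$; facets are maximal faces; a simplex is a complex with exactly one facet. $\Gamma\setminus E=\{F\in\Gamma:E\not\subseteq F\}$. For a face $F$, $\mathrm{link}_\Gamma(F)=\{G\in\Gamma: F\cap G=\emptyset,\ F\cup G\in\Gamma\}$, and $\mathrm{link}_\Gamma(v)=\mathrm{link}_\Gamma(\{v\})$. The Alexander dual is $\Gamma^\vee=\{F\subseteq[n]:[n]\setminus F\notin\Gamma\}$. Vertex decomposability (not assumed pure), defined recursively: $\Gamma$ is vertex decomposable if it is a simplex (including $\emptyset$ and $\{\emptyset\}$), or it contains a vertex $v$ such that (i) $v$ is a shedding vertex, i.e. no face of $\mathrm{link}_\Gamma(v)$ is a facet of $\Gamma\setminus\{v\}$, and (ii) both $\Gamma\setminus\{v\}$ and $\mathrm{link}_\Gamma(v)$ are vertex decomposable. $d$-closure. Let $d\ge1$. $\langle[n]\rangle^{[d-1]}$ denotes the complex of all subsets of $[n]$ with at most $d$ elements. $\Delta_d(\Gamma)$ is the complex on $[n]$ such that: its $d$-dimensional faces are exactly the $d$-dimensional faces of $\Gamma$; all subsets of $[n]$ with at most $d$ elements are faces; a subset with more than $d+1$ elements is a face iff all its $(d+1)$-element subsets are faces of $\Gamma$. A complex is a $d$-closure if it equals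 $\Delta_d(\Sigma)$ for some complex $\Sigma$ on $[n]$. Chordality. A face is free if it is contained in a unique facet (facets are free). A simplicial face of a $d$-closure is a free face of dimension $d-1$. $\Gamma\wr_E=\Gamma$ if $E\notin\Gamma$ and $(\Gamma\setminus E)\cup\{E\}$ if $E\in\Gamma$. A simplicial order of a $d$-closure $\Gamma$ is a sequence $E_1,\dots,E_t$ of $(d-1)$-dimensional faces such that, for each $i\ge1$, $E_i$ is a simplicial face but not a facet of $\Gamma\wr_{E_1}\cdots\wr_{E_{i-1}}$ (which is again a $d$-closure), and $\Gamma\wr_{E_1}\cdots\wr_{E_t}=\langle[n]\rangle^{[d-1]}$. $\Gamma$ is $d$-chordal if $\Delta_d(\Gamma)=\langle[n]\rangle^{[d-1]}$ or $\Delta_d(\Gamma)$ admits a simplicial order; it is chordal if it is $d$-chordal for every $d\ge1$. *)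

(* Defs.v *)
From mathcomp Require Import all_boot.

Set Implicit Arguments.
Unset Strict Implicit.
Unset Printing Implicit Defensive.

(* Complexes on [n] are families of subsets of 'I_n. A face F has dimension
   #|F| - 1; a face of dimension k is written below as one with k + 1 elements,
   which avoids truncated subtraction. *)

(* The void complex set0 qualifies, and singletons need not be faces. *)
Definition simplicial_complex n (G : {set {set 'I_n}}) : Prop :=
  forall E F : {set 'I_n}, E \subset F -> F \in G -> E \in G.

Definition facets n (G : {set {set 'I_n}}) : {set {set 'I_n}} :=
  [set F | maxset [in G] F].

Definition is_simplex n (G : {set {set 'I_n}}) : bool := #|facets G| == 1.

Definition deletion n (G : {set {set 'I_n}}) (E : {set 'I_n}) :
    {set {set 'I_n}} :=
  [set F in G | ~~ (E \subset F)].

Definition link n (G : {set {set 'I_n}}) (F : {set 'I_n}) : {set {set 'I_n}} :=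
  [set H in G | [disjoint F & H] && (F :|: H \in G)].

Definition alexander_dual n (G : {set {set 'I_n}}) : {set {set 'I_n}} :=
  [set F | ~: F \notin G].

Definition shedding_vertex n (G : {set {set 'I_n}}) (v : 'I_n) : Prop :=
  [set v] \in G /\
  forall F, F \in link G [set v] -> F \notin facets (deletion G [set v]).

(* The void complex has no facet, so it is listed separately as a base case;
   {∅} is covered by is_simplex. *)
Inductive vertex_decomposable n (G : {set {set 'I_n}}) : Prop :=
| VDsimplex of G = set0 \/ is_simplex G
| VDshedding v of
    shedding_vertex G v &
    vertex_decomposable (deletion G [set v]) &
    vertex_decomposable (link G [set v]).

(* ⟨[n]⟩^[d-1]: the complete (d-1)-skeleton. *)
Definition complete_skeleton n d : {set {set 'I_n}} :=
  [set F : {set 'I_n} | #|F| <= d].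

Definition d_closure n d (G : {set {set 'I_n}}) : {set {set 'I_n}} :=
  [set F : {set 'I_n} |
    [|| #|F| <= d,
        (#|F| == d.+1) && (F \in G) |
        (d.+1 < #|F|) &&
        [forall H : {set 'I_n}, (H \subset F) && (#|H| == d.+1) ==> (H \in G)]]].

Definition free_face n (G : {set {set 'I_n}}) (E : {set 'I_n}) : bool :=
  (E \in G) && (#|[set F in facets G | E \subset F]| == 1).

Definition simplicial_face n d (G : {set {set 'I_n}}) (E : {set 'I_n}) : bool :=
  free_face G E && (#|E| == d).

(* Γ≀_E: the faces properly containing E are removed, E itself is kept. *)
Definition wr n (G : {set {set 'I_n}}) (E : {set 'I_n}) : {set {set 'I_n}} :=
  if E \in G then E |: deletion G E else G.

(* The empty sequence is allowed. For d >= 1, if G is a d-closure and #|E| = d,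
   then wr G E is again a d-closure, so simplicial_face is only ever applied to
   d-closures here when G is one. *)
Definition simplicial_order n d (G : {set {set 'I_n}}) (s : seq {set 'I_n}) :
    Prop :=
  [/\ forall E, E \in s -> E \in G /\ #|E| = d,
      forall i, i < size s ->
        let Gi := foldl (@wr n) G (take i s) in
        let Ei := nth set0 s i in
        simplicial_face d Gi Ei /\ Ei \notin facets Gi
    & foldl (@wr n) G s = complete_skeleton n d].

Definition d_chordal n d (G : {set {set 'I_n}}) : Prop :=
  d_closure d G = complete_skeleton n d \/
  exists s : seq {set 'I_n}, simplicial_order d (d_closure d G) s.

Definition chordal n (G : {set {set 'I_n}}) : Prop :=
  forall d, 0 < d -> d_chordal d G.

(* Main.v *)
Require Import Defs.
From mathcomp Require Import all_boot.

Set Implicit Arguments.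
Unset Strict Implicit.
Unset Printing Implicit Defensive.

(** A [d]-closure is the clique complex of the [d.+1]-uniform clutter [C] of its
    [d]-dimensional faces, and a simplicial order amounts to emptying [C] by
    repeatedly choosing a [d]-set [E] whose closed neighbourhood is a clique and
    discarding all the members of [C] above [E] ([eliminable]).

    Let [v] be a shedding vertex of [G]. In the dual [K] of [G] taken inside a
    vertex set [V], the dual of [deletion G v] inside [V :\ v] is the link of
    [v], and the dual of [link G v] is the deletion of [v]; the shedding
    condition says that a set avoiding [v] is a face of [K] as soon as its whole
    boundary lies in the link of [v]. So an elimination of the link, one
    dimension lower, lifts by adding [v] to each [E]: the neighbourhood of
    [v |: E] is the cone with apex [v] over that of [E], a clique because the
    shedding condition supplies its subsets avoiding [v]
    ([eliminable_link_deletion]). After this lift only the sets avoiding [v]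
    remain, and these are eliminated by the induction hypothesis for
    [link G v] ([eliminable_dual]). The descent in dimension ends at clutters of
    singletons, which a single step with [E = set0] empties
    ([eliminable_singletons]).

    The dual of a simplex with facet [F0] consists of the sets not containing
    [V :\: F0]. It is eliminated by the same lifting principle, applied first to
    a vertex of [V :\: F0]; the sets that avoid this vertex form a complete
    clutter, where any vertex will do ([eliminable_avoiding]). *)

Lemma card_setD1 n (A : {set 'I_n}) a k :
  a \in A -> #|A| = k.+1 -> #|A :\ a| = k.
Proof. by move=> aA; rewrite (cardsD1 a) aA => -[]. Qed.

(** Every point of a set with two elements or more survives the removal of some
    other point. *)
Lemma subset_of_facets n (A V : {set 'I_n}) k :
  #|A| = k.+2 -> (forall w, w \in A -> A :\ w \subset V) -> A \subset V.
Proof.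
move=> cardA sAV; apply/subsetP=> a aA.
have /card_gt0P[c] : 0 < #|A :\ a| by rewrite (card_setD1 aA cardA).
rewrite !inE => /andP[c'a cA]; apply: (subsetP (sAV c cA)).
by rewrite !inE aA eq_sym c'a.
Qed.

(** * Elimination of uniform clutters *)

Definition closed_nbhd n (C : {set {set 'I_n}}) (E : {set 'I_n}) :
    {set 'I_n} :=
  E :|: [set x | x |: E \in C].

(** The vertex [x] witnesses that [E] lies in some member of [C], which is what
    makes [E] a non-facet of the clique complex. *)
Inductive eliminable n d (C : {set {set 'I_n}}) : Prop :=
| Eliminated of C = set0
| Eliminate (E : {set 'I_n}) (x : 'I_n) of
    #|E| = d & x \notin E & x |: E \in C &
    (forall A : {set 'I_n},
       #|A| = d.+1 -> A \subset closed_nbhd C E -> A \in C) &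
    eliminable d (deletion C E).

Definition clutter_link n (v : 'I_n) (C : {set {set 'I_n}}) :
    {set {set 'I_n}} :=
  [set F : {set 'I_n} | (v \notin F) && (v |: F \in C)].

(** The empty set is contained in everything, so one elimination step with
    [E = set0] removes all of a clutter of singletons. *)
Lemma eliminable_singletons n (C : {set {set 'I_n}}) :
  (forall F, F \in C -> #|F| = 1) -> eliminable 0 C.
Proof.
move=> C1; case: (set_0Vmem C) => [->|[F FC]]; first exact: Eliminated.
have /eqP/cards1P[x defF] := C1 F FC.
apply: (@Eliminate n 0 C set0 x); rewrite ?cards0 ?inE ?setU0 -?defF //.
  move=> A /eqP/cards1P[y ->]; rewrite /closed_nbhd set0U sub1set inE.
  by rewrite setU0.
by apply: Eliminated; apply/setP=> B; rewrite !inE sub0set andbF.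
Qed.

(** An elimination of the link of [v] lifts to [C] by adding [v] to every [E]:
    it removes the members of [C] through [v] and no other one. The last
    hypothesis is the shedding condition, read in the dual. *)
Lemma eliminable_link_deletion n d v (C : {set {set 'I_n}}) :
  eliminable d (clutter_link v C) ->
  eliminable d.+1 (deletion C [set v]) ->
  (forall A : {set 'I_n}, #|A| = d.+2 -> v \notin A ->
     (forall H : {set 'I_n},
        H \subset A -> #|H| = d.+1 -> H \in clutter_link v C) ->
     A \in C) ->
  eliminable d.+1 C.
Proof.
move defL: (clutter_link v C) => L elimL.
elim: elimL C defL => {}L => [-> | E x cardE xE xEL cliqueE _ IH] C defL elimD
  shed.
  suff -> : C = deletion C [set v] by [].
  apply/setP=> F; rewrite !inE sub1set; case FC: (F \in C) => //=.
  apply/esym/negP=> vF.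
  have : F :\ v \in clutter_link v C by rewrite inE setD11 setD1K.
  by rewrite defL inE.
have : x |: E \in clutter_link v C by rewrite defL.
rewrite !inE negb_or => /andP[/andP[v'x v'E] vxEC].
have linkN y : y != v -> y \in closed_nbhd C (v |: E) -> y \in closed_nbhd L E.
  by move=> y'v; rewrite -defL !inE negb_or (negPf y'v) eq_sym y'v v'E setUCA.
apply: (@Eliminate n d.+1 C (v |: E) x).
- by rewrite cardsU1 v'E cardE.
- by rewrite !inE negb_or eq_sym v'x.
- by rewrite setUCA.
- move=> A cardA /subsetP subA; case vA: (v \in A).
    have : A :\ v \in L.
      apply: cliqueE; first exact: card_setD1.
      by apply/subsetP=> y /setD1P[y'v yA]; apply: linkN (subA y yA).
    by rewrite -defL inE setD11 setD1K.
  apply: shed; rewrite ?vA // => H /subsetP sHA cardH.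
  apply: cliqueE => //; apply/subsetP=> y /sHA yA; apply: linkN (subA y yA).
  by apply: contraFneq vA => <-.
apply: IH.
- apply/setP=> F; rewrite -defL !inE; case vF: (v \in F) => //=; congr (_ && ~~ _).
  apply/idP/idP=> [/subsetP sE|]; last exact: setUS.
  apply/subsetP=> y yE; have := sE y; rewrite !inE yE orbT => /(_ isT).
  by case/orP=> // /eqP yv; rewrite -yv yE in v'E.
- suff -> : deletion (deletion C (v |: E)) [set v] = deletion C [set v] by [].
  apply/setP=> F; rewrite !inE sub1set subUset sub1set.
  by case: (v \in F); rewrite /= ?andbF ?andbT.
- move=> A cardA v'A shedA; rewrite inE subUset sub1set (negPf v'A) /= andbT.
  apply: shed => // H sHA cardH; have := shedA H sHA cardH.
  by rewrite inE => /andP[].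
Qed.

(** * Clutters dual to a simplicial complex *)

(** With [B = V :\: F0] these are the faces of the dual of the simplex with
    facet [F0]; the flag [p] is off for the dual of the void complex, where
    nothing is to be avoided. The induction removes a vertex [v] such that [B]
    is not inside [V :\ v], which makes the shedding condition automatic. *)
Lemma eliminable_avoiding n d p (V B : {set 'I_n}) :
  eliminable d [set F : {set 'I_n} | [&& F \subset V, #|F| == d.+1
                                       & ~~ (p && (B \subset F))]].
Proof.
move: {2}#|V| (erefl #|V|) => m; elim: m d V B => [|m IH] d V B cardV.
  apply: Eliminated; apply/setP=> F; rewrite !inE (cards0_eq cardV) subset0.
  by case: eqP => // ->; rewrite cards0.
case: d => [|d].
  by apply: eliminable_singletons => F; rewrite inE => /and3P[_ /eqP].
have [/andP[p1 /eqP B0] | pB] := boolP (p && (B == set0)).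
  by apply: Eliminated; apply/setP=> F; rewrite !inE p1 B0 sub0set !andbF.
have [v vV BV]: exists2 v, v \in V & ~~ (p && (B \subset V :\ v)).
  have [/andP[p1 sBV]|BV] := boolP (p && (B \subset V)).
    move: pB; rewrite p1 => /set0Pn[b bB]; exists b; first exact: (subsetP sBV).
    by apply/negP=> /subsetP/(_ b bB); rewrite setD11.
  have /set0Pn[v vV] : V != set0 by rewrite -card_gt0 cardV.
  exists v => //; apply: contra BV => /andP[-> /subset_trans]; apply.
  exact: subD1set.
have cardVv : #|V :\ v| = m by apply: card_setD1.
have defL : clutter_link v [set F : {set 'I_n} | [&& F \subset V, #|F| == d.+2
    & ~~ (p && (B \subset F))]] = [set F : {set 'I_n} | [&& F \subset V :\ v,
    #|F| == d.+1 & ~~ (p && (B :\ v \subset F))]].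
  apply/setP=> F; rewrite !inE subsetD1 subUset sub1set vV cardsU1 -subDset.
  by case: (v \in F); rewrite //= ?andbF ?andbT.
apply: (@eliminable_link_deletion n d v).
- by rewrite defL; apply: IH.
- suff -> : deletion [set F : {set 'I_n} | [&& F \subset V, #|F| == d.+2
    & ~~ (p && (B \subset F))]] [set v] = [set F : {set 'I_n} |
    [&& F \subset V :\ v, #|F| == d.+2 & ~~ (p && (B \subset F))]].
    exact: IH.
  apply/setP=> F; rewrite !inE sub1set subsetD1.
  by case: (v \in F); rewrite /= ?andbF ?andbT.
move=> A cardA v'A; rewrite defL => shedA.
have sAV : A \subset V :\ v.
  apply: (subset_of_facets (k := d) cardA) => w wA.
  have := shedA (A :\ w); rewrite subD1set (card_setD1 wA cardA).
  by move=> /(_ isT erefl); rewrite inE => /and3P[].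
rewrite inE cardA eqxx (subset_trans sAV (subD1set _ _)) /=.
by apply: contra BV => /andP[-> /subset_trans]; apply.
Qed.

(** The dual is taken inside a vertex set [V] that shrinks along the recursive
    definition of vertex decomposability. *)
Definition dual_clutter n (V : {set 'I_n}) (G : {set {set 'I_n}}) k :
    {set {set 'I_n}} :=
  [set F : {set 'I_n} | [&& F \subset V, #|F| == k & V :\: F \notin G]].

Lemma clutter_link_dual n (V : {set 'I_n}) (G : {set {set 'I_n}}) v k :
  v \in V ->
  clutter_link v (dual_clutter V G k.+1) =
    dual_clutter (V :\ v) (deletion G [set v]) k.
Proof.
move=> vV; apply/setP=> F; rewrite !inE subUset sub1set vV cardsU1 subsetD1.
rewrite sub1set !inE eqxx andbF andbT setDDl.
by case: (v \in F); rewrite /= ?andbF ?andbT.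
Qed.

Lemma deletion_dual n (V : {set 'I_n}) (G : {set {set 'I_n}}) v k :
  simplicial_complex G -> v \in V ->
  deletion (dual_clutter V G k) [set v] =
    dual_clutter (V :\ v) (link G [set v]) k.
Proof.
move=> Gcplx vV; apply/setP=> F; rewrite !inE sub1set subsetD1.
case: (boolP (v \in F)) => v'F; rewrite /= ?andbF ?andbT //.
have -> : [set v] :|: (V :\ v) :\: F = V :\: F.
  apply/setP=> y; rewrite !inE; case: (eqVneq y v) => [->|] //=.
  by rewrite v'F vV.
have -> : [disjoint [set v] & (V :\ v) :\: F].
  by rewrite disjoints1 !inE eqxx andbF.
congr [&& _, _ & ~~ _]; rewrite /=; case VFG: (V :\: F \in G); rewrite ?andbF //.
by rewrite (Gcplx _ (V :\: F)) // setSD ?subD1set.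
Qed.

Lemma simplicial_deletion n (G : {set {set 'I_n}}) E :
  simplicial_complex G -> simplicial_complex (deletion G E).
Proof.
move=> Gcplx A F sAF; rewrite !inE => /andP[/(Gcplx _ _ sAF) -> /=].
by apply: contra => /subset_trans; apply.
Qed.

Lemma simplicial_link n (G : {set {set 'I_n}}) E :
  simplicial_complex G -> simplicial_complex (link G E).
Proof.
move=> Gcplx A F sAF; rewrite !inE => /and3P[/(Gcplx _ _ sAF) -> /= EF EFG].
rewrite disjoint_sym (disjointWl sAF) 1?disjoint_sym //=.
by apply: Gcplx EFG; apply: setUS.
Qed.

(** A face of the link of [v] lies in the deletion of [v], and there the shedding
    condition keeps it from being maximal. *)
Lemma shedding_extension n (G : {set {set 'I_n}}) v F :
  simplicial_complex G -> shedding_vertex G v -> F \in link G [set v] ->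
  exists w, [/\ w != v, w \notin F & w |: F \in G].
Proof.
move=> Gcplx [_ shed] Flink; have := shed F Flink.
move: Flink; rewrite !inE disjoints1 => /and3P[FG v'F _].
have FD : F \in deletion G [set v] by rewrite inE FG sub1set.
case: (@maxset_exists _ [in deletion G [set v]] _ FD) => M maxM sFM nmaxF.
have MD : M \in deletion G [set v] := maxsetp maxM.
have /subsetPn[w wM wF] : ~~ (M \subset F).
  apply: contra nmaxF => sMF.
  by have -> : F = M by apply/eqP; rewrite eqEsubset sFM sMF.
move: MD; rewrite inE sub1set => /andP[MG v'M].
exists w; split=> //; first by apply: contraNneq v'M => <-.
by apply: Gcplx MG; rewrite subUset sub1set wM.
Qed.

(** Taking complements, [V :\: F] lies in the facet [F0] exactly when
    [V :\: F0] lies in [F]. *)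
Lemma dual_clutter_simplex n (V : {set 'I_n}) (G : {set {set 'I_n}}) :
  simplicial_complex G -> G = set0 \/ is_simplex G ->
  exists p (B : {set 'I_n}), forall F : {set 'I_n},
    F \subset V -> (V :\: F \in G) = p && (B \subset F).
Proof.
move=> Gcplx [-> | /cards1P[F0 facF0]].
  by exists false, set0 => F _; rewrite inE.
have : F0 \in facets G by rewrite facF0 set11.
rewrite inE => /maxsetp /= F0G; exists true, (V :\: F0) => F sFV /=.
rewrite subDset setUC -subDset; apply/idP/idP=> [FG|]; last first.
  by move/Gcplx; apply.
case: (@maxset_exists _ [in G] _ FG) => M maxM sM.
suff <- : M = F0 by [].
by apply/set1P; rewrite -facF0 inE.
Qed.

(** The shedding condition in its dual form is proved by contradiction: if [A]
    were not a face of the dual of the link, its complement would be a face of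
    the link, so some [w |: (V :\ v) :\: A] would be a face of the deletion; as
    this is the complement of [A :\ w], the boundary of [A] would not lie in the
    dual of the deletion. *)
Lemma eliminable_dual n d (V : {set 'I_n}) (G : {set {set 'I_n}}) :
  simplicial_complex G -> (forall F, F \in G -> F \subset V) ->
  vertex_decomposable G -> eliminable d (dual_clutter V G d.+1).
Proof.
move=> Gcplx GV Gvd; elim: Gvd d V Gcplx GV => {}G.
  move=> simplexG d V Gcplx GV.
  have [p [B defG]] := dual_clutter_simplex V Gcplx simplexG.
  suff -> : dual_clutter V G d.+1 = [set F : {set 'I_n} | [&& F \subset V,
    #|F| == d.+1 & ~~ (p && (B \subset F))]] by apply: eliminable_avoiding.
  by apply/setP=> F; rewrite !inE; case: (boolP (F \subset V)) => // /defG ->.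
move=> v shedv _ IHdel _ IHlink d V Gcplx GV.
have vV : v \in V by rewrite -sub1set; apply: GV; case: shedv.
case: d => [|d].
  by apply: eliminable_singletons => F; rewrite inE => /and3P[_ /eqP].
have delV F : F \in deletion G [set v] -> F \subset V :\ v.
  by rewrite inE sub1set subsetD1 => /andP[/GV -> ->].
have linkV F : F \in link G [set v] -> F \subset V :\ v.
  by rewrite inE disjoints1 subsetD1 => /and3P[/GV -> ->].
apply: (@eliminable_link_deletion n d v).
- rewrite clutter_link_dual //.
  by apply: IHdel => //; apply: simplicial_deletion.
- rewrite deletion_dual //.
  by apply: IHlink => //; apply: simplicial_link.
move=> A cardA v'A; rewrite clutter_link_dual // => shedA.
have facetA w : w \in A -> A :\ w \in dual_clutter (V :\ v)
    (deletion G [set v]) d.+1.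
  move=> wA; apply: shedA; first exact: subD1set.
  exact: card_setD1.
have sAV : A \subset V.
  apply: (subset_of_facets (k := d) cardA) => w /facetA.
  by rewrite inE subsetD1 => /and3P[/andP[]].
rewrite inE sAV cardA eqxx /=; apply/negP=> VAG.
have AVlink : (V :\ v) :\: A \in link G [set v].
  rewrite inE disjoints1 !inE eqxx andbF /= (Gcplx _ _ _ VAG) ?setSD ?subD1set //=.
  by apply: Gcplx VAG; rewrite subUset sub1set !inE v'A vV setSD ?subD1set.
have [w [v'w w'VA wG]] := shedding_extension Gcplx shedv AVlink.
have wA : w \in A.
  have wV : w \in V by move/GV: wG; rewrite subUset sub1set => /andP[].
  by move: w'VA; rewrite !inE wV v'w /= andbT negbK.
have := facetA w wA; rewrite inE => /and3P[_ _ /negP]; apply.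
suff -> : (V :\ v) :\: (A :\ w) = w |: (V :\ v) :\: A.
  by rewrite inE wG sub1set !inE eqxx andbF orbF eq_sym v'w.
apply/setP=> y; rewrite !inE; case: (eqVneq y w) => [->|] //=.
by rewrite v'w (subsetP sAV).
Qed.

(** * From eliminations to simplicial orders *)

Definition clique_complex n d (C : {set {set 'I_n}}) : {set {set 'I_n}} :=
  [set F : {set 'I_n} |
    [forall H : {set 'I_n}, (H \subset F) && (#|H| == d.+1) ==> (H \in C)]].

(** The three cases of the definition of a [d]-closure say the same thing: the
    condition on [d.+1]-subsets is empty for small sets, and it concerns only
    the set itself in size [d.+1]. *)
Lemma d_closureE n d (G : {set {set 'I_n}}) :
  d_closure d G = clique_complex d [set F in G | #|F| == d.+1].
Proof.
apply/setP=> F; rewrite !inE.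
have -> : [forall H : {set 'I_n}, (H \subset F) && (#|H| == d.+1) ==>
    (H \in [set F in G | #|F| == d.+1])] =
  [forall H : {set 'I_n}, (H \subset F) && (#|H| == d.+1) ==> (H \in G)].
  by apply: eq_forallb => H; rewrite !inE; case: eqP; rewrite ?andbF ?andbT.
case: (ltngtP #|F| d.+1) => [Fd|Fd|Fd].
- rewrite -ltnS Fd /=; apply/esym/forallP=> H; apply/implyP=> /andP[sHF /eqP Hd].
  by have := subset_leq_card sHF; rewrite Hd leqNgt Fd.
- by rewrite leqNgt (ltnW Fd).
rewrite Fd ltnn /= orbF; apply/idP/forallP=> [FG H|]; last first.
  by move/(_ F); rewrite subxx Fd eqxx.
apply/implyP=> /andP[sHF /eqP Hd]; suff -> : H = F by [].
by apply/eqP; rewrite eqEcard sHF Hd Fd leqnn.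
Qed.

Lemma clique_complexP n d (C : {set {set 'I_n}}) (F : {set 'I_n}) :
  reflect (forall H : {set 'I_n}, H \subset F -> #|H| = d.+1 -> H \in C)
    (F \in clique_complex d C).
Proof.
rewrite inE; apply: (iffP forallP) => FC H; last first.
  by apply/implyP=> /andP[sHF /eqP]; apply: FC.
by move=> sHF /eqP Hd; have := FC H; rewrite sHF Hd.
Qed.

Lemma clique_complex_small n d (C : {set {set 'I_n}}) (F : {set 'I_n}) :
  #|F| <= d -> F \in clique_complex d C.
Proof.
move=> Fd; apply/clique_complexP=> H /subset_leq_card HF Hd.
by move: (leq_trans HF Fd); rewrite Hd ltnn.
Qed.

Lemma clique_complex0 n d : clique_complex d set0 = complete_skeleton n d.
Proof.
apply/setP=> F; rewrite [RHS]inE.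
apply/idP/idP=> [/clique_complexP FC|]; last exact: clique_complex_small.
rewrite leqNgt; apply/negP=> dF; have : 0 < #|[set H : {set 'I_n} | (H \subset F)
    && (#|H| == d.+1)]| by rewrite cards_draws bin_gt0.
case/card_gt0P=> H; rewrite inE => /andP[sHF /eqP Hd].
by have := FC H sHF Hd; rewrite inE.
Qed.

Lemma wr_clique_complex n d (C : {set {set 'I_n}}) (E : {set 'I_n}) :
  #|E| = d -> wr (clique_complex d C) E = clique_complex d (deletion C E).
Proof.
move=> Ed; rewrite /wr clique_complex_small ?Ed //; apply/setP=> F.
rewrite in_setU1 in_set; apply/orP/clique_complexP.
  case=> [/eqP -> H /subset_leq_card | /andP[/clique_complexP FC EF] H sHF Hd].
    by rewrite Ed => le_Hd Hd; rewrite Hd ltnn in le_Hd.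
  rewrite inE FC //=; apply: contra EF => /subset_trans; exact.
move=> FC; have [FE|FE] := eqVneq F E; [by left | right; apply/andP; split].
  by apply/clique_complexP=> H sHF Hd; have := FC H sHF Hd; rewrite inE => /andP[].
apply/negP=> sEF; have /subsetPn[x xF xE] : ~~ (F \subset E).
  by apply: contra FE => sFE; rewrite eqEsubset sFE.
have := FC (x |: E); rewrite subUset sub1set xF sEF cardsU1 xE Ed.
by move=> /(_ isT erefl); rewrite inE subsetUr andbF.
Qed.

(** The closed neighbourhood of [E] contains every face above [E], so it is the
    only facet there once it is a clique. *)
Lemma simplicial_clique_complex n d (C : {set {set 'I_n}}) (E : {set 'I_n}) x :
  #|E| = d -> x \notin E -> x |: E \in C ->
  (forall A : {set 'I_n},
     #|A| = d.+1 -> A \subset closed_nbhd C E -> A \in C) ->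
  simplicial_face d (clique_complex d C) E /\
    E \notin facets (clique_complex d C).
Proof.
move=> Ed xE xEC cliqueE.
have NC : closed_nbhd C E \in clique_complex d C.
  by apply/clique_complexP=> H sHN Hd; apply: cliqueE.
have sEN : E \subset closed_nbhd C E by apply: subsetUl.
have subN F : F \in clique_complex d C -> E \subset F -> F \subset closed_nbhd C E.
  move=> /clique_complexP FC sEF; apply/subsetP=> y yF.
  rewrite !inE; case: (boolP (y \in E)) => //= yE.
  by apply: FC; rewrite ?subUset ?sub1set ?yF // cardsU1 yE Ed.
split; last first.
  rewrite inE; apply/negP=> /maxsetP[_ /(_ _ NC sEN) defN].
  have : x \in closed_nbhd C E by rewrite !inE xEC orbT.
  by rewrite defN (negPf xE).
rewrite /simplicial_face /free_face clique_complex_small ?Ed // eqxx andbT /=.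
apply/cards1P; exists (closed_nbhd C E); apply/setP=> F; rewrite !inE.
apply/andP/eqP=> [[/maxsetP[FC maxF] sEF]|->].
  by rewrite (maxF _ NC) // subN.
split=> //; apply/maxsetP; split=> // M MC sNM.
by apply/eqP; rewrite eqEsubset sNM subN // (subset_trans sEN).
Qed.

Lemma eliminable_simplicial_order n d (C : {set {set 'I_n}}) :
  eliminable d C -> exists s, simplicial_order d (clique_complex d C) s.
Proof.
elim=> {}C => [-> | E x Ed xE xEC cliqueE _ [s [sE simps ends]]].
  by exists [::]; split=> //=; apply: clique_complex0.
exists (E :: s); split=> [F | [|i] | ].
- rewrite inE => /orP[/eqP -> | /sE[_ Fd]]; split=> //;
    by apply: clique_complex_small; rewrite ?Ed ?Fd.
- by move=> _; apply: simplicial_clique_complex xEC cliqueE.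
- by rewrite /= wr_clique_complex //; apply: simps.
by rewrite /= wr_clique_complex.
Qed.

Theorem theorem5p2 (n : nat) (G : {set {set 'I_n}})
    (hG : simplicial_complex G) (hVD : vertex_decomposable G) :
  chordal (alexander_dual G).
Proof.
move=> d _; right; rewrite d_closureE; apply: eliminable_simplicial_order.
have -> : [set F in alexander_dual G | #|F| == d.+1] = dual_clutter setT G d.+1.
  by apply/setP=> F; rewrite !inE subsetT setTD andbC.
by apply: eliminable_dual => // F _; apply: subsetT.
Qed.
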